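(* Let $K$ be a field, let $\mathcal{A}$ be a laterally complete commutative regular $K$-algebra, and let $X$ and $Y$ be faithful laterally complete $\mathcal{A}$-modules. The following conditions are equivalent: (i) $\Gamma(X)=\Gamma(Y)$, where $\Gamma(\cdot)$ denotes the passport; (ii) the $\mathcal{A}$-modules $X$ and $Y$ are isomorphic.
   Context: Algebras. A commutative $K$-algebra $\mathcal{A}$ with unity $\mathbf{1}$ is regular if for every $a\in\mathcal{A}$ there is $b\in\mathcal{A}$ with $a=a^2b$. The set $\nabla=\{e\in\mathcal{A}:e^2=e\}$ of idempotents is a Boolean algebra under $e\le f\iff ef=e$, with $e\wedge f=ef$, $e\vee f=e+f-ef$ and complement $\mathbf{1}-e$. The support $s(a)\in\nabla$ of $a\in\mathcal{A}$ is the smallest idempotent $e$ with $ea=a$ (it exists in a regular algebra). Elements $a,b$ are disjoint if $ab=0$. $\mathcal{A}$ is laterally complete ($l$-complete) if $\nabla$ is a complete Boolean algebra and for any family $\{a_i\}_{i\in I}$ of pairwise disjoint elements of $\mathcal{A}$ there is $a\in\mathcal{A}$ with $as(a_i)=a_i$ for all $i\in I$. A partition of unity in $\nabla$ is a family of pairwise disjoint idempotents with supremum $\mathbf{1}$. For $0\ne e\in\nabla$ put $\mathcal{A}_e=e\mathcal{A}$ (a laterally complete commutative regular algebra with unity $e$). Modules. Modules are unital. For an $\mathcal{A}$-module $X$ and $0\neq e\in\nabla$ put $X_e=eX$, an $\mathcal{A}_e$-module. $X$ is faithful if for every nonzero $e\in\nabla$ there is $x\in X$ with $ex\ne0$. $X$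 is regular if for every $x\in X$ and $L\subset\nabla$, $ex=0$ for all $e\in L$ implies $(\sup L)x=0$. A regular $\mathcal{A}$-module $X$ is laterally complete ($l$-complete) if for every family $\{x_i\}_{i\in I}\subset X$ and every partition of unity $\{e_i\}_{i\in I}$ in $\nabla$ there is $x\in X$ (necessarily unique, denoted $\mathrm{mix}_{i\in I}(e_ix_i)$) with $e_ix=e_ix_i$ for all $i$. For $E\subset X$, $\mathrm{mix}(E)$ is the set of all mixings $\mathrm{mix}_{i\in I}(e_ix_i)$ with $x_i\in E$ and $\{e_i\}_{i\in I}$ a partition of unity in $\nabla$. $\mathrm{Lin}(Y,\mathcal{A})$ is the set of all finite sums $\sum_k a_ky_k$ with $a_k\in\mathcal{A}$, $y_k\in Y$. A family $\{x_i\}_{i\in I}$ in $X$ is $\mathcal{A}$-linearly independent if for pairwise distinct indices $i_1,\dots,i_n$ and $a_1,\dots,a_n\in\mathcal{A}$, $\sum_k a_kx_{i_k}=0$ implies $a_1=\dots=a_n=0$. An $\mathcal{A}$-Hamel basis of an $l$-complete module $X$ is an $\mathcal{A}$-linearly independent family $\{x_i\}_{i\in I}$ with $\mathrm{mix}(\mathrm{Lin}(\{x_i\}_{i\in I},\mathcal{A}))=X$. These notions are applied also to $X_e$ over $\mathcal{A}_e$. Homogeneity. A faithful $l$-complete $\mathcal{A}$-module $X$ is $\gamma$-homogeneous ($\gamma$ a cardinal) if it has an $\mathcal{A}$-Hamel basis $\{x_i\}_{i\in I}$ with $\mathrm{card}\,I=\gamma$. For $0\ne e\in\nabla$, $\varkappa_X(e)$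 is the smallest cardinal $\gamma$ such that the $\mathcal{A}_e$-module $X_e$ is $\gamma$-homogeneous (when such a cardinal exists). $X$ is strictly $\gamma$-homogeneous if it is $\gamma$-homogeneous and $\gamma=\varkappa_X(e)$ for all nonzero $e\in\nabla$. Passport. For a faithful $l$-complete $\mathcal{A}$-module $X$, there is a unique (up to reindexing) partition of unity $\{e_i\}_{i\in I}$ in $\nabla$ into nonzero idempotents together with pairwise different cardinals $\{\gamma_i\}_{i\in I}$ such that $X_{e_i}$ is a strictly $\gamma_i$-homogeneous $\mathcal{A}_{e_i}$-module for all $i\in I$. The passport of $X$ is the set of pairs $\Gamma(X)=\{(e_i,\gamma_i)\}_{i\in I}$; equality of passports is equality of these sets of pairs. *)

(* Defs.v *)
From HB Require Import structures.
From mathcomp Require Import all_boot all_order all_algebra.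
From mathcomp Require Import boolp classical_sets functions cardinality.

Set Implicit Arguments.
Unset Strict Implicit.
Unset Printing Implicit Defensive.

Import Order.TTheory GRing.Theory.

Local Open Scope classical_set_scope.
Local Open Scope ring_scope.
Local Open Scope card_scope.

(* The rings below are [comPzRingType]s, i.e. possibly trivial, so that the
   corner [eA] makes sense for every idempotent [e], including [e = 0]. *)

Definition nabla (R : comPzRingType) := {e : R | e * e == e}.

Section Nabla.
Variable R : comPzRingType.

HB.instance Definition _ := Choice.on (nabla R).
HB.instance Definition _ := [isSub of nabla R for sval].

Implicit Types e f g : nabla R.

Lemma nablaP e : val e * val e = val e.
Proof. exact/eqP/(valP e). Qed.

Definition nabla_le e f := val f * val e == val e.

Fact nabla_le_refl : reflexive nabla_le.
Proof. by move=> e; rewrite /nabla_le nablaP. Qed.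

Fact nabla_le_anti : antisymmetric nabla_le.
Proof.
by move=> e f /andP[/eqP fe /eqP ef]; apply/val_inj; rewrite -fe mulrC.
Qed.

Fact nabla_le_trans : transitive nabla_le.
Proof.
move=> f e g /eqP fe /eqP gf; apply/eqP.
by rewrite -fe mulrA gf.
Qed.

Fact nabla_display : Order.disp_t. Proof. exact: Order.Disp tt tt. Qed.

HB.instance Definition _ := Order.Le_isPOrder.Build nabla_display (nabla R)
  nabla_le_refl nabla_le_anti nabla_le_trans.

Definition nabla1 : nabla R := exist _ 1 (introT eqP (mulr1 1)).

End Nabla.

(* The ring [eR], with unity [e]; it is the set of [a] such that [e * a = a]
   because [e] is idempotent. *)
Definition corner_pred (R : comPzRingType) (e : nabla R) : R -> bool :=
  fun a => val e * a == a.

Definition corner (R : comPzRingType) (e : nabla R) :=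
  {a : R | corner_pred e a}.

Section Corner.
Variables (R : comPzRingType) (e : nabla R).

Fact corner_zmod_closed : zmod_closed (corner_pred e).
Proof.
split=> [|a b]; rewrite !unfold_in ?mulr0 // => /eqP ea /eqP eb.
by rewrite mulrBr ea eb.
Qed.
HB.instance Definition _ := GRing.isZmodClosed.Build R (corner_pred e)
  corner_zmod_closed.

HB.instance Definition _ := Choice.on (corner e).
HB.instance Definition _ := [isSub of corner e for sval].
HB.instance Definition _ :=
  [SubChoice_isSubZmodule of corner e by <:].

Fact corner_mul_subproof (a b : corner e) :
  val e * (val a * val b) == val a * val b.
Proof. by rewrite mulrA (eqP (valP a)). Qed.

Definition corner_one : corner e := exist _ (val e) (valP e).
Definition corner_mul (a b : corner e) : corner e :=
  exist _ (val a * val b) (corner_mul_subproof a b).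

Fact corner_mulA : associative corner_mul.
Proof. by move=> a b c; apply/val_inj; rewrite /= mulrA. Qed.
Fact corner_mulC : commutative corner_mul.
Proof. by move=> a b; apply/val_inj; rewrite /= mulrC. Qed.
Fact corner_mul1 : left_id corner_one corner_mul.
Proof. by move=> a; apply/val_inj/eqP; exact: (valP a). Qed.
Fact corner_mulDl : left_distributive corner_mul +%R.
Proof. by move=> a b c; apply/val_inj; rewrite /= mulrDl. Qed.

HB.instance Definition _ := GRing.Zmodule_isComPzRing.Build (corner e)
  corner_mulA corner_mulC corner_mul1 corner_mulDl.

End Corner.

(* The [eR]-module [eX]. *)
Definition restr_pred (R : comPzRingType) (X : lmodType R) (e : nabla R) :
  X -> bool := fun x => val e *: x == x.

Definition restr (R : comPzRingType) (X : lmodType R) (e : nabla R) :=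
  {x : X | restr_pred e x}.

Section Restr.
Variables (R : comPzRingType) (X : lmodType R) (e : nabla R).

Fact restr_zmod_closed : zmod_closed (@restr_pred R X e).
Proof.
split=> [|x y]; rewrite !unfold_in ?scaler0 // => /eqP ex /eqP ey.
by rewrite scalerBr ex ey.
Qed.
HB.instance Definition _ := GRing.isZmodClosed.Build X (@restr_pred R X e)
  restr_zmod_closed.

HB.instance Definition _ := Choice.on (restr X e).
HB.instance Definition _ := [isSub of restr X e for sval].
HB.instance Definition _ :=
  [SubChoice_isSubZmodule of restr X e by <:].

Fact restr_scale_subproof (a : corner e) (x : restr X e) :
  val e *: (val a *: val x) == val a *: val x.
Proof. by rewrite scalerA (eqP (valP a)). Qed.

Definition restr_scale (a : corner e) (x : restr X e) : restr X e :=
  exist _ (val a *: val x) (restr_scale_subproof a x).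

Fact restr_scaleA a b x :
  restr_scale a (restr_scale b x) = restr_scale (a * b) x.
Proof. by apply/val_inj; rewrite /= scalerA. Qed.
Fact restr_scale1 : left_id 1 restr_scale.
Proof. by move=> x; apply/val_inj/eqP; exact: (valP x). Qed.
Fact restr_scaleDr : right_distributive restr_scale +%R.
Proof. by move=> a x y; apply/val_inj; rewrite /= scalerDr. Qed.
Fact restr_scaleDl x : {morph restr_scale^~ x : a b / a + b}.
Proof. by move=> a b; apply/val_inj; rewrite /= scalerDl. Qed.

HB.instance Definition _ := GRing.Zmodule_isLmodule.Build (corner e)
  (restr X e) restr_scaleA restr_scale1 restr_scaleDr restr_scaleDl.

End Restr.

Section Algebra.
Variable R : comPzRingType.

Definition regular_ring := forall a : R, exists b : R, a = a ^+ 2 * b.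

Definition is_support (a : R) (s : nabla R) :=
  val s * a = a /\ (forall e : nabla R, val e * a = a -> (s <= e)%O).

Definition laterally_complete_ring :=
  (forall L : set (nabla R), supremums L !=set0) /\
  (forall (I : Type) (a : I -> R),
     (forall i j, i <> j -> a i * a j = 0) ->
     exists b : R, forall i s, is_support (a i) s -> b * val s = a i).

(* Zero idempotents and infinite index types are allowed. *)
Definition partition_of_unity (I : Type) (e : I -> nabla R) :=
  (forall i j, i <> j -> val (e i) * val (e j) = 0) /\
  supremums (range e) (nabla1 R).

End Algebra.

Section Module.
Variables (R : comPzRingType) (X : lmodType R).

Definition faithful_module :=
  forall e : nabla R, val e != 0 -> exists x : X, val e *: x != 0.

Definition regular_module :=
  forall (x : X) (L : set (nabla R)) (s : nabla R),
    supremums L s -> (forall e, L e -> val e *: x = 0) -> val s *: x = 0.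

Definition is_mix (I : Type) (e : I -> nabla R) (x : I -> X) (z : X) :=
  forall i, val (e i) *: z = val (e i) *: x i.

Definition laterally_complete_module :=
  regular_module /\
  (forall (I : Type) (e : I -> nabla R) (x : I -> X),
     partition_of_unity e -> exists z, is_mix e x z).

Definition mix (E : set X) : set X :=
  [set z | exists (I : Type) (e : I -> nabla R) (x : I -> X),
     [/\ partition_of_unity e, forall i, E (x i) & is_mix e x z]].

Definition Lin (Y : set X) : set X :=
  [set z | exists (n : nat) (a : 'I_n -> R) (y : 'I_n -> X),
     (forall k, Y (y k)) /\ z = \sum_(k < n) a k *: y k].

Definition lin_indep (I : Type) (x : I -> X) :=
  forall (n : nat) (i : 'I_n -> I) (a : 'I_n -> R),
    injective i -> \sum_(k < n) a k *: x (i k) = 0 -> forall k, a k = 0.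

Definition hamel_basis (I : Type) (x : I -> X) :=
  lin_indep x /\ mix (Lin (range x)) = [set: X].

(* Throughout, a cardinal is given by a type [T] of that cardinality, and
   cardinals are compared by [#=] and [#<=] on full sets. *)
Definition homogeneous (T : Type) :=
  [/\ faithful_module, laterally_complete_module &
      exists (I : Type) (x : I -> X), hamel_basis x /\ [set: I] #= [set: T]].

End Module.

Section Passport.
Variables (R : comPzRingType) (X : lmodType R).

(* [T] represents the cardinal varkappa_X(e) *)
Definition is_kappa (e : nabla R) (T : Type) :=
  homogeneous (restr X e) T /\
  (forall U : Type, homogeneous (restr X e) U -> [set: T] #<= [set: U]).

Definition strictly_homogeneous (T : Type) :=
  homogeneous X T /\ (forall e : nabla R, val e != 0 -> is_kappa e T).

End Passport.

Definition passport_family (R : comPzRingType) (X : lmodType R)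
    (I : Type) (e : I -> nabla R) (T : I -> Type) :=
  [/\ partition_of_unity e,
      forall i, val (e i) != 0,
      forall i j, i <> j -> ~ ([set: T i] #= [set: T j]) &
      forall i, strictly_homogeneous (restr X (e i)) (T i)].

(* The passport as a set of pairs (idempotent, cardinal): a binary predicate,
   invariant under equipotence of its second argument. When [R] is regular and
   laterally complete and [X] is faithful and laterally complete, the family
   [f, U] exists and is unique up to reindexing and equipotence. *)
Definition passport (R : comPzRingType) (X : lmodType R)
    (e : nabla R) (T : Type) : Prop :=
  exists (I : Type) (f : I -> nabla R) (U : I -> Type),
    passport_family X f U /\ (exists i, f i = e /\ [set: U i] #= [set: T]).

Definition same_passport (R : comPzRingType) (X Y : lmodType R) :=
  forall (e : nabla R) (T : Type), passport X e T <-> passport Y e T.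

Definition isomorphic_modules (R : comPzRingType) (X Y : lmodType R) :=
  exists f : {linear X -> Y}, bijective f.

(* Main.v *)
Require Import Defs.
From HB Require Import structures.
From mathcomp Require Import all_boot all_order all_algebra.
From mathcomp Require Import boolp classical_sets functions cardinality.

Set Implicit Arguments.
Unset Strict Implicit.
Unset Printing Implicit Defensive.

Import Order.TTheory GRing.Theory.

Local Open Scope classical_set_scope.
Local Open Scope ring_scope.
Local Open Scope card_scope.

(** An isomorphism carries Hamel bases to Hamel bases over every idempotent, so
isomorphic modules have the same passport. The converse is the substance: the
passport has to be shown to exist, and to determine the module.

Everything is a matter of locality. Call a property of idempotents dense below
[e] if every nonzero idempotent below [e] has a nonzero idempotent below it with
the property. By Zorn's lemma a dense property is realised on a partition of [e]
([exhaustion]). Hence, in a laterally complete module, elements that are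
prescribed on densely many idempotents can be glued ([glue]), and regularity of
the module says that an element vanishing on densely many parts of [e] vanishes
on [e] ([regular_moduleP]). A Hamel basis of [eX] is a family in [X] that is
independent over [e] and of which every vector is, on densely many parts of [e],
a finite linear combination ([hamel_basisP], [basis_restr]); no mixing occurs in
this description, and it is local in [e].

Existence of the passport. A maximal free set over [e] spans over some part of
[e], since otherwise vectors outside its span could be glued to a vector that
enlarges it ([local_basis]). Cardinals being well ordered, bases of least
cardinality over all smaller idempotents exist on densely many idempotents
([strict_basis_dense]). For each cardinal the idempotents that are strictly
homogeneous of this cardinality have a largest one, and these largest idempotents
form the passport ([passport_exists]).

The passport determines the module. If it is [(e_i, T_i)] for both [X] and [Y],
then over each [e_i] both modules have bases indexed by [T_i]. Relate [z] in [X]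
to [w] in [Y] when, on densely many idempotents, they have the same coordinates
in these bases. Gluing makes the relation total in both directions, independence
and regularity make it single-valued in both directions, and it is linear; hence
it is the graph of an isomorphism ([isomorphic_of_bases]). *)

(** * Idempotents and exhaustion *)

Section Idempotents.
Variable R : comPzRingType.
Implicit Types (e p q : R) (D M : set R).

(** The idempotents under consideration are kept as ring elements, so that
products, differences and complements need no coercion; [nabla] reappears only
where the order-theoretic notions of suprema and partitions are translated. *)
Definition part e q := [/\ q * q = q, e * q = q & q != 0].

(** Density in the sense of forcing: [D] need not be closed downwards, and every
property below that holds locally is recovered from a dense set of parts. *)
Definition dense e D := forall q, part e q -> exists2 q', part q q' & D q'.

Lemma part_refl e : e * e = e -> e != 0 -> part e e.
Proof. by []. Qed.

Lemma part_trans e p q : part e p -> part p q -> part e q.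
Proof. by move=> [_ ep _] [qq pq q0]; split => //; rewrite -pq mulrA ep. Qed.

Lemma part_le1 e q : part e q -> part 1 q.
Proof. by case=> ? ? ?; split; rewrite ?mul1r. Qed.

Lemma part_mull q p : q * q = q -> p * p = p -> q * p != 0 -> part q (q * p).
Proof. move=> qq pp qp0; split => //; first by rewrite mulrACA qq pp.
by rewrite mulrA qq. Qed.

Lemma part_mulr q p : q * q = q -> p * p = p -> q * p != 0 -> part p (q * p).
Proof. by move=> qq pp; rewrite mulrC; exact: part_mull. Qed.

Lemma idem_compl e : e * e = e -> (1 - e) * (1 - e) = 1 - e.
Proof. by move=> ee; rewrite mulrBr mulr1 mulrBl mul1r ee subrr subr0. Qed.

Lemma dense_sub e D D' : D `<=` D' -> dense e D -> dense e D'.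
Proof. by move=> DD' De q /De[q' qq' /DD']; exists q'. Qed.

Lemma dense_part e q D : part e q -> dense e D -> dense q D.
Proof. by move=> eq De p qp; apply: De; exact: part_trans qp. Qed.

Definition exhausts e M := [/\ forall p, M p -> p * p = p /\ e * p = p,
  forall p q, M p -> M q -> p <> q -> p * q = 0 &
  forall q, part e q -> exists2 p, M p & q * p != 0].

(** A maximal disjoint family chosen inside [D] leaves nothing over: a part of
[e] disjoint from it would contain a further member of [D]. *)
Lemma exhaustion e D : dense e D -> exists2 M, M `<=` D & exhausts e M.
Proof.
move=> De.
pose disj M := forall p q, M p -> M q -> p <> q -> p * q = 0.
pose P : set (set R) := [set M | M `<=` D `&` part e /\ disj M].
have [F FP totF|M [[MD dM] maxM]] := @Zorn_bigcup R P.
  split=> [p [M /FP[MD _] /MD]//|p q [M FM Mp] [N FN Nq]].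
  have [MN|NM] := totF _ _ FM FN.
    by have [_ dN] := FP _ FN; apply: dN => //; exact: MN.
  by have [_ dM] := FP _ FM; apply: dM => //; exact: NM.
exists M; first by move=> p /MD[].
split=> // [p /MD[_ []]//|q eq].
apply: contrapT => nM.
have qM p : M p -> q * p = 0.
  by move=> Mp; apply: contrapT => /eqP qp; apply: nM; exists p.
have [q' qq' Dq'] := De q eq.
have q'M p : M p -> q' * p = 0.
  by move=> Mp; case: qq' => _ <- _; rewrite mulrAC qM// mul0r.
apply: (maxM (M `|` [set q'])).
  split=> [p|]; first by left.
  move=> /(_ q' (or_intror erefl)) Mq'.
  by case: qq' => q'q' _ /eqP[]; rewrite -q'q' q'M.
split=> [p [/MD//|->]|p p' [Mp|->] [Mp'|->]//].
- by split=> //; exact: part_trans eq qq'.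
- exact: dM.
- by rewrite mulrC q'M.
- by rewrite q'M.
Qed.

(** Mixing needs a partition of the unity of the whole ring, which is obtained
from a partition of [e] by adding the complement of [e]. *)
Lemma exhausts_compl e M : e * e = e -> exhausts e M ->
  exhausts 1 (M `|` [set 1 - e]).
Proof.
move=> ee [Me dM exM].
have Mc p : M p -> p * (1 - e) = 0.
  by case/Me=> _ ep; rewrite mulrBr mulr1 mulrC ep subrr.
split.
- move=> p [/Me[pp _]|->]; first by rewrite mul1r.
  by rewrite mul1r idem_compl.
- move=> p q [Mp|->] [Mq|->]//.
  + exact: dM.
  + by rewrite Mc.
  + by rewrite mulrC Mc.
- move=> q [qq _ q0].
  have [qe0|qe0] := eqVneq (q * e) 0.
    by exists (1 - e); [right|rewrite mulrBr mulr1 qe0 subr0].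
  have [|p Mp qep] := exM (q * e); first exact: part_mulr.
  exists p; first by left.
  by apply: contra_neq qep => qp; rewrite mulrAC qp mul0r.
Qed.

Definition mknabla q (qq : q * q = q) : nabla R := exist _ q (introT eqP qq).

Lemma nabla_leP (e f : nabla R) : (e <= f)%O <-> val f * val e = val e.
Proof. by split=> [/eqP//|?]; apply/eqP. Qed.

(** Suprema of idempotents are described by disjointness alone, since a part of
[s] disjoint from [L] could be subtracted from [s]. *)
Lemma supremumsP (L : set (nabla R)) (s : nabla R) : supremums L s <->
  (forall l, L l -> val s * val l = val l) /\
  (forall q, part (val s) q -> exists2 l, L l & q * val l != 0).
Proof.
split=> [[ubs lbs]|[ubs dL]].
  split=> [l Ll|q [qq sq q0]]; first exact/nabla_leP/ubs.
  apply: contrapT => nL.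
  have qL l : L l -> q * val l = 0.
    by move=> Ll; apply: contrapT => /eqP ql; apply: nL; exists l.
  have sqi : (val s - q) * (val s - q) = val s - q.
    rewrite mulrBr !mulrBl nablaP qq sq mulrC sq; rewrite subrr subr0//.
  have /lbs/nabla_leP/= : ubound L (mknabla sqi).
    move=> l Ll; apply/nabla_leP => /=.
    by rewrite mulrBl qL// subr0; exact/nabla_leP/ubs.
  rewrite mulrBl nablaP mulrC sq => /eqP; rewrite subr_eq addrC -subr_eq subrr.
  by rewrite eq_sym (negbTE q0).
split=> [l /ubs/nabla_leP//|u ubu]; apply/nabla_leP.
apply: contrapT => /eqP.
rewrite eq_sym -subr_eq0 -{1}[val s]mul1r -mulrBl mulrC => su0.
have [|l Ll] := dL (val s * (1 - val u)).
  by apply: part_mull su0; [exact: nablaP|exact/idem_compl/nablaP].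
have /nabla_leP ul := ubu _ Ll.
by rewrite -mulrA mulrBl mul1r ul subrr mulr0 eqxx.
Qed.

Lemma partition_of_unityP (I : Type) (e : I -> nabla R) :
  partition_of_unity e <->
  (forall i j, i <> j -> val (e i) * val (e j) = 0) /\
  (forall q, part 1 q -> exists i, q * val (e i) != 0).
Proof.
split=> -[de]; first move/supremumsP=> [_ dL].
  by split=> // q /dL[_ [i _ <-]]; exists i.
move=> dL; split=> //; apply/supremumsP; split=> [l _|q /dL[i]].
  by rewrite mul1r.
by exists (e i) => //; exists i.
Qed.

Lemma exhausts_partition M : exhausts 1 M ->
  exists2 e : M -> nabla R, partition_of_unity e & forall p : M, val (e p) = val p.
Proof.
move=> [Mi dM exM].
have Mp (p : M) : val p * val p = val p by case: (Mi _ (set_valP p)).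
exists (fun i => mknabla (Mp i)) => //; apply/partition_of_unityP; split=> /=.
  move=> p q pq; apply: dM; [exact: set_valP..|].
  by move=> vpq; apply: pq; exact: val_inj.
by move=> q /exM[p pM qp]; exists (SigSub (mem_set pM)).
Qed.

(** Regularity is used only in this form: the coefficient [b] becomes invertible
on some nonzero idempotent, the support [b * c] of [b] cut down to [e]. *)
Lemma regular_part : regular_ring R -> forall e b, e * e = e -> e * b != 0 ->
  exists q c, part e q /\ q = c * b.
Proof.
move=> Rreg e b ee eb; have [c bc] := Rreg b.
exists (e * (b * c)), (e * c); split; last by rewrite mulrA mulrAC.
apply: part_mull => //.
  by rewrite mulrA (mulrAC b c) -expr2 -bc.
apply: contra_neq eb => ebc.
by rewrite bc expr2 -mulrA mulrCA ebc mulr0.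
Qed.

Lemma regular_ring_local0 : regular_ring R -> forall e b, e * e = e ->
  dense e [set q | q * b = 0] -> e * b = 0.
Proof.
move=> Rreg e b ee eb; apply: contrapT => /eqP/(regular_part Rreg ee).
move=> [q [c [eq qE]]]; have [q' [q'q' qq' q'0] /= q'b] := eb q eq.
by move/eqP: q'0; rewrite -qq' qE -mulrA (mulrC b) q'b mulr0.
Qed.

End Idempotents.

(** * Locality and gluing in modules *)

Section Modules.
Variables (R : comPzRingType) (X : lmodType R).
Implicit Types (e p q : R) (D M : set R) (z : X).

Definition separated := forall z e, e * e = e ->
  dense e [set q | q *: z = 0] -> e *: z = 0.

(** The annihilators of [z] below [e] have supremum [e] as soon as they are dense
in [e], so regularity says that vanishing is a local property. *)
Lemma regular_moduleP : regular_module X <-> separated.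
Proof.
split=> [Xreg z e ee dz|Xsep z L s supL Lz].
  pose L := [set l : nabla R | e * val l = val l /\ val l *: z = 0].
  apply: (Xreg z L (mknabla ee)) => [|l []//].
  apply/supremumsP; split=> [l []//|q eq].
  have [q' qq' q'z] := dz q eq; have [q'i q'q q'0] := qq'.
  exists (mknabla q'i) => /=; last by rewrite q'q.
  by split=> //=; case: (part_trans eq qq').
have [_ dL] := (supremumsP _ _).1 supL.
apply: Xsep; first exact: nablaP.
move=> q /[dup] sq /dL[l Ll ql]; exists (q * val l).
  by apply: part_mull ql; [case: sq|exact: nablaP].
by rewrite /= -scalerA Lz// scaler0.
Qed.

Hypothesis Xlc : laterally_complete_module X.

Lemma lcomplete_separated : separated.
Proof. by apply/regular_moduleP; case: Xlc. Qed.

Lemma glue e M (x : R -> X) : e * e = e -> exhausts e M ->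
  exists z, forall p, M p -> p *: z = p *: x p.
Proof.
move=> ee /(exhausts_compl ee)/exhausts_partition[f fpart fE].
have [_ /(_ _ f (fun i => x (val i)) fpart)[z zx]] := Xlc.
exists z => p Mp; have pM : p \in M `|` [set 1 - e] by apply/mem_set; left.
by have := zx (SigSub pM); rewrite fE.
Qed.

End Modules.

(** * Linear combinations and local bases *)

Section Combinations.
Variables (R : comPzRingType) (X : lmodType R) (I : Type).
Implicit Types (x y : I -> X) (s : seq (R * I)) (e q a : R).

Definition lincomb x s := \sum_(p <- s) p.1 *: x p.2.
(** An index may occur several times in [s]; the coefficient collects all its
occurrences, which lets combinations be added by concatenating lists. *)
Definition coef s t := \sum_(p <- s | `[< p.2 = t >]) p.1.
Definition scale_seq a s := [seq (a * p.1, p.2) | p <- s].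

Lemma lincomb_cat x s s' : lincomb x (s ++ s') = lincomb x s + lincomb x s'.
Proof. by rewrite /lincomb big_cat. Qed.

Lemma lincomb_scale x a s : lincomb x (scale_seq a s) = a *: lincomb x s.
Proof.
by rewrite /lincomb big_map scaler_sumr; apply: eq_bigr => p _; rewrite scalerA.
Qed.

Lemma coef_scale a s t : coef (scale_seq a s) t = a * coef s t.
Proof. by rewrite /coef big_map mulr_sumr. Qed.

End Combinations.

Lemma lincomb_coef_eqType (R : comPzRingType) (X : lmodType R) (I : eqType)
    (s : seq (R * I)) : exists2 u : seq I, uniq u &
  (forall x : I -> X, lincomb x s = \sum_(t <- u) coef s t *: x t) /\
  (forall t, t \notin u -> coef s t = 0).
Proof.
pose u := undup [seq p.2 | p <- s].
exists u; first exact: undup_uniq.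
have su (p : R * I) : p \in s -> p.2 \in u by move=> ps; rewrite mem_undup map_f.
split=> [x|t tu]; last first.
  rewrite /coef big_seq_cond big1// => p /andP[/su pu /asboolP pt].
  by rewrite -pt pu in tu.
rewrite /lincomb /coef.
under [RHS]eq_bigr do rewrite scaler_suml big_mkcond.
rewrite exchange_big/= [LHS]big_seq [RHS]big_seq.
apply: eq_bigr => p ps.
rewrite (bigD1_seq p.2)/= ?undup_uniq ?su//.
rewrite asboolT// big1 ?addr0// => t tp; rewrite asboolF//.
by move=> pt; rewrite pt eqxx in tp.
Qed.

Section Bases.
Variables (R : comPzRingType) (X : lmodType R) (I : Type).
Implicit Types (x y : I -> X) (s : seq (R * I)) (e q a : R).

Lemma lincomb_coef s : exists2 u : seq {classic I}, uniq u &
  (forall x, lincomb x s = \sum_(t <- u) coef s t *: x t) /\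
  (forall t : {classic I}, t \notin u -> coef s t = 0).
Proof. exact: (lincomb_coef_eqType X (I := {classic I})). Qed.

(** The coefficients vanish when the independence of some family forces them to;
[x] may be another family with the same indices, even in another module. *)
Lemma lincomb0 x q s : (forall t, q * coef s t = 0) -> q *: lincomb x s = 0.
Proof.
have [u _ [-> _]] := lincomb_coef s => q0.
by rewrite scaler_sumr big1// => t _; rewrite scalerA q0 scale0r.
Qed.

Lemma eq_lincomb q x y s : (forall t, q *: x t = q *: y t) ->
  q *: lincomb x s = q *: lincomb y s.
Proof.
move=> xy; rewrite /lincomb !scaler_sumr; apply: eq_bigr => p _.
by rewrite scalerA mulrC -scalerA xy scalerA mulrC -scalerA.
Qed.

Definition indep e x :=
  forall s, e *: lincomb x s = 0 -> forall t, e * coef s t = 0.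

Definition span_locus x (z : X) : set R :=
  [set q | exists s, q *: z = q *: lincomb x s].

(** Instead of mixing over a partition, spanning asks for a linear combination on
a dense set of idempotents: the two agree by exhaustion ([hamel_basisP]), and the
dense form is visibly inherited by the parts of [e]. *)
Definition spans e x := forall z, dense e (span_locus x z).

Definition basis e x := indep e x /\ spans e x.

Lemma span_locus_mul x z p q : span_locus x z q -> span_locus x z (p * q).
Proof. by move=> [s qs]; exists s; rewrite -!scalerA qs. Qed.

Lemma indep_part e q x : part e q -> indep e x -> indep q x.
Proof.
move=> [qq eq _] ix s qs0 t.
have := ix (scale_seq q s); rewrite lincomb_scale qs0 scaler0 => /(_ erefl t).
by rewrite coef_scale mulrA eq.
Qed.

Lemma basis_part e q x : part e q -> basis e x -> basis q x.
Proof.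
move=> eq [ix sx]; split; first exact: indep_part ix.
by move=> z; exact: dense_part (sx z).
Qed.

Lemma basis_eq q x y : (forall t, q *: x t = q *: y t) -> basis q x -> basis q y.
Proof.
move=> xy [ix sx]; split=> [s|z p qp].
  by rewrite -(eq_lincomb s xy); exact: ix.
have [p' pp' [s p's]] := sx z p qp; exists p' => //; exists s.
have [_ qp' _] := part_trans qp pp'.
by rewrite p's -qp' mulrC -!scalerA (eq_lincomb s xy).
Qed.

Lemma basis_local e x : regular_ring R -> e * e = e ->
  dense e [set q | basis q x] -> basis e x.
Proof.
move=> Rreg ee dx; split=> [s es0 t|z q eq].
  apply: regular_ring_local0 => // q /[dup] eq /dx[q' qq' [ix _]].
  exists q' => //=; apply: ix; have [_ eq' _] := part_trans eq qq'.
  by rewrite -eq' mulrC -scalerA es0 scaler0.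
have [q' qq' [_ /(_ z q')]] := dx q eq.
have [q'q' _ q'0] := qq'.
by move=> /(_ (part_refl q'q' q'0))[p q'p zp]; exists p => //; exact: part_trans q'p.
Qed.

Lemma LinP x z : Lin (range x) z <-> exists s, z = lincomb x s.
Proof.
split=> [[n [a [y [yx ->]]]]|[s ->]].
  have /choice[t tE] k : exists t, x t = y k by have [t _ <-] := yx k; exists t.
  exists [seq (a k, t k) | k <- index_enum 'I_n].
  by rewrite /lincomb big_map; apply: eq_bigr => k _; rewrite tE.
exists (size s), (fun k => (tnth (in_tuple s) k).1).
exists (fun k => x (tnth (in_tuple s) k).2).
by split=> [k|]; [exact: imageT|rewrite /lincomb (big_tnth _ _ s)].
Qed.

Lemma lin_indepP x : lin_indep x <-> indep 1 x.
Proof.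
split=> [ix s|ix n i a inj_i ai0 k].
  have [u uu [-> nu]] := lincomb_coef s.
  rewrite scale1r (big_tnth _ _ u) => /(ix (size u) (tnth (in_tuple u))) u0 t.
  rewrite mul1r; have [tu|] := boolP ((t : {classic I}) \in u); last exact: nu.
  have /tnthP[k ->] : (t : {classic I}) \in in_tuple u by [].
  by apply: u0; exact: (elimT (tuple_uniqP (in_tuple u)) uu).
pose s := [seq (a k, i k) | k <- index_enum 'I_n].
have := ix s; rewrite scale1r /lincomb big_map => /(_ ai0 (i k)).
rewrite mul1r /coef big_map (bigD1 k) ?asboolT//= big1 ?addr0// => j.
by case/andP=> /asboolP/inj_i ->; rewrite eqxx.
Qed.

(** A dense set of idempotents on which [z] is a combination is exhausted by a
partition of unity, and [z] is the mixing of the corresponding combinations. *)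
Lemma hamel_basisP x : hamel_basis x <-> basis 1 x.
Proof.
rewrite /hamel_basis lin_indepP; split=> -[ix sx]; split=> //.
  move=> z q q1; have : mix (Lin (range x)) z by rewrite sx.
  move=> [J [e [v [/partition_of_unityP[_ /(_ q q1)[i qi]] vL zv]]]].
  exists (q * val (e i)); first by apply: part_mull qi; [case: q1|exact: nablaP].
  by have [s vs] := (LinP _ _).1 (vL i); exists s; rewrite -!scalerA zv vs.
rewrite -subTset => z _.
have [M Mz exM] := exhaustion (sx z); have [f fpart fE] := exhausts_partition exM.
have /choice[s sE] (i : M) : exists s, val i *: z = val i *: lincomb x s.
  by have [s ?] := Mz _ (set_valP i); exists s.
exists M, f, (fun i => lincomb x (s i)); split=> //.
  by move=> i; apply/LinP; exists (s i).
by move=> i; rewrite fE.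
Qed.

End Bases.

Lemma basis_bij (R : comPzRingType) (X : lmodType R) (T U : Type) e (x : T -> X)
  (f : U -> T) : bijective f -> basis e x -> basis e (x \o f).
Proof.
move=> [g fK gK] [ix sx]; split=> [s es0 t|z q /(sx z)[q' qq' [s q's]]].
  pose s' := [seq (p.1, f p.2) | p <- s].
  have -> : coef s t = coef s' (f t).
    rewrite /coef big_map; apply: eq_bigl => p /=; apply: asbool_equiv_eq.
    by split=> [->//|/(can_inj fK)].
  by apply: ix; rewrite /lincomb big_map.
exists q' => //; exists [seq (p.1, g p.2) | p <- s].
by rewrite q's /lincomb big_map; under [in RHS]eq_bigr do rewrite /= gK.
Qed.

(** * Existence of local bases *)

Section ModuleBases.
Variables (R : comPzRingType) (X : lmodType R).
Hypotheses (Rreg : regular_ring R) (Xlc : laterally_complete_module X).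
Implicit Types (e q : R) (S : set X).

(** Bases indexed by the same set on disjoint idempotents are glued member by
member, because being a basis is a local property of a family. *)
Lemma basis_glue (T : Type) e : e * e = e ->
  dense e [set q | exists x : T -> X, basis q x] -> exists x : T -> X, basis e x.
Proof.
move=> ee /exhaustion[M Mb exM].
have /choice[x xb] p : exists x : T -> X, M p -> basis p x.
  have [/Mb[x xb]|nMp] := pselect (M p); first by exists x.
  by exists (fun=> 0).
have /choice[z zx] t : exists z, forall p, M p -> p *: z = p *: x p t.
  exact: (glue Xlc (fun p => x p t) ee exM).
exists z; apply: basis_local => // q eq.
have [Mi _ /(_ q eq)[p Mp qp]] := exM; have [pp _] := Mi p Mp.
have [qq _ _] := eq.
exists (q * p); first exact: part_mull.
apply: (basis_part (part_mulr qq pp qp)).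
by apply: basis_eq (xb p Mp) => t; rewrite zx.
Qed.

(** The combinations range over lists in [X] rather than over the type of
elements of [S], so that free sets can be compared along inclusions. *)
Definition free_set e S := forall s : seq (R * X),
  (forall p, p \in s -> S p.2) -> e *: lincomb id s = 0 ->
  forall t, e * coef s t = 0.

Lemma free_set_indep e S : free_set e S -> indep e (fun i : S => val i).
Proof.
move=> fS s es0 t; pose s' := [seq (p.1, val p.2) | p <- s].
have -> : coef s t = coef s' (val t).
  rewrite /coef big_map; apply: eq_bigl => p /=; apply: asbool_equiv_eq.
  by split=> [->//|vE]; exact: val_inj.
apply: fS; last by rewrite /lincomb big_map.
by move=> _ /mapP[p _ ->]; exact: set_valP.
Qed.

Lemma lincomb_set S (s : seq (R * X)) : (forall p, p \in s -> S p.2) ->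
  exists s' : seq (R * S), lincomb (fun i : S => val i) s' = lincomb id s.
Proof.
elim: s => [|p s ihs] sS; first by exists [::]; rewrite /lincomb !big_nil.
have [|s' s'E] := ihs; first by move=> p' ps; apply: sS; rewrite inE ps orbT.
have Sp : p.2 \in S by apply/mem_set/sS; rewrite inE eqxx.
exists ((p.1, SigSub Sp) :: s'); move: s'E.
by rewrite /lincomb !big_cons => ->.
Qed.

(** If [z] entered a relation with coefficient [b] nonzero on [e], then [b] would
be invertible on some part of [e], and there [z] would be a combination of [S]. *)
Lemma free_setU1 e S z : e * e = e -> free_set e S ->
  (forall q, part e q -> ~ span_locus (fun i : S => val i) z q) ->
  free_set e (S `|` [set z]).
Proof.
move=> ee fS zS s sS es0.
pose s' := [seq p <- s | p.2 != z].
have s'S p : p \in s' -> S p.2.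
  by rewrite mem_filter => /andP[/eqP pz /sS[]].
have sE : lincomb id s = coef s z *: z + lincomb id s'.
  rewrite /lincomb (bigID (fun p => p.2 == z))/= big_filter; congr (_ + _).
  rewrite /coef scaler_suml; apply: eq_big => [p|p /eqP->//].
  by apply/eqP/asboolP.
have coefz : e * coef s z = 0.
  apply: contrapT => /eqP/(regular_part Rreg ee)[q [c [eq qE]]].
  have [qq eqq _] := eq; apply: zS eq _.
  have [s'' s''E] := lincomb_set s'S.
  exists (scale_seq (- (c * e)) s''); rewrite lincomb_scale s''E.
  have ez : e *: (coef s z *: z) = - (e *: lincomb id s').
    by apply/eqP; rewrite -addr_eq0 -scalerDr -sE es0.
  suff -> : - (c * e) *: lincomb id s' = q *: z by rewrite scalerA qq.
  rewrite scaleNr -scalerA -scalerN -ez !scalerA mulrCA -qE.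
  by rewrite eqq.
have es'0 : e *: lincomb id s' = 0.
  by move: es0; rewrite sE scalerDr scalerA coefz scale0r add0r.
move=> t; have [->//|tz] := eqVneq t z.
suff -> : coef s t = coef s' t by exact: fS.
rewrite /coef big_filter_cond; apply: eq_bigl => p.
by have [->|] := eqVneq p.2 z; rewrite ?andbT// asboolF//; apply/eqP; rewrite eq_sym.
Qed.

(** Take [S] maximal among the sets free on [e]. If [S] spanned on no part of [e],
then densely many parts would carry a vector free over [S]; these glue to a
single vector that is free over [S] on all of [e], against maximality. *)
Lemma local_basis e : e * e = e -> e != 0 ->
  exists q S, part e q /\ exists x : S -> X, basis q x.
Proof.
move=> ee e0.
have [F FP totF|S [fS maxS]] := @Zorn_bigcup X [set S | free_set e S].
  move=> s sF.
  (* A finite list of vectors of the union lies in one member of the chain. *)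
  suff [[s0 _]|[S FS sS]] : s = [::] \/ exists2 S, F S & forall p, p \in s -> S p.2.
    by rewrite s0 => t; rewrite /coef big_nil mulr0.
    by apply: FP FS s sS.
  elim: s sF => [|p s ihs] sF; first by left.
  right; have [S FS Sp] := sF p (mem_head _ _).
  have [|s0|[S' FS' S's]] := ihs.
  - by move=> p' ps; apply: sF; rewrite inE ps orbT.
  - by exists S => // p'; rewrite s0 inE => /eqP ->.
  - have [SS'|S'S] := totF _ _ FS FS'.
      exists S' => // p'; rewrite inE => /predU1P[->|/S's//]; exact: SS'.
    exists S => // p'; rewrite inE => /predU1P[->//|/S's]; exact: S'S.
have [[q eq sq]|nspan] := pselect (exists2 q, part e q &
    spans q (fun i : S => val i)).
  exists q, S; split=> //; exists (fun i : S => val i); split=> //.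
  by apply: (indep_part eq); exact: free_set_indep.
have dz : dense e [set q | exists z, forall q', part q q' ->
    ~ span_locus (fun i : S => val i) z q'].
  move=> q eq; apply: contrapT => nq; apply: nspan; exists q => // z q1 qq1.
  apply: contrapT => nq1; apply: nq; exists q1 => //; exists z => q' q1q' zq'.
  by apply: nq1; exists q'.
have [M Mz exM] := exhaustion dz.
have /choice[z zP] p : exists z, M p -> forall q', part p q' ->
    ~ span_locus (fun i : S => val i) z q'.
  have [/Mz[z zp]|nMp] := pselect (M p); first by exists z.
  by exists 0.
have [w wz] := glue Xlc z ee exM.
have wS q : part e q -> ~ span_locus (fun i : S => val i) w q.
  move=> eq qw; have [Mi _ /(_ q eq)[p Mp qp]] := exM; have [pp _] := Mi p Mp.
  have [qq _ _] := eq.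
  apply: (zP p Mp _ (part_mulr qq pp qp)).
  have [s] := span_locus_mul p qw; rewrite mulrC -!scalerA.
  by move=> pw; exists s; rewrite -!scalerA -wz.
have /maxS[] := free_setU1 ee fS wS.
split=> [t|]; first by left.
move=> /(_ w (or_intror erefl)) Sw; apply: (wS e); first by split.
by exists [:: (1, SigSub (mem_set Sw))]; rewrite /lincomb big_seq1 scale1r.
Qed.

End ModuleBases.

(** * Cardinals *)

Lemma card_eq_bijective (T U : Type) : [set: T] #= [set: U] ->
  exists f : T -> U, bijective f.
Proof.
pose inT V (v : V) : [set: V] := SigSub (mem_set (I : [set: V] v)).
have inTK V (v : [set: V]) : inT V (val v) = v by exact: val_inj.
move=> /card_bijP[f [g fK gK]]; exists (fun t => val (f (inT T t))).
by exists (fun u => val (g (inT U u))) => [t|u]; rewrite inTK ?fK ?gK.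
Qed.

Lemma injective_card_le (T U : Type) (f : T -> U) :
  injective f -> [set: T] #<= [set: U].
Proof.
move=> fI; have fT : f @` [set: T] #= [set: T] by apply: inj_card_eq => ? ? _ _ /fI.
by rewrite -(card_le_eql fT); exact: subset_card_le.
Qed.

(** Well-foundedness of cardinals, by matching all the types simultaneously: a
maximal set [G] of selectors that differ pairwise in every coordinate must
exhaust some [F j], else a selector avoiding [G] in each coordinate could be
added; each element of [F j] then has its own partner in every [F k]. *)
Lemma least_card (J : Type) (F : J -> Type) (j0 : J) :
  exists j, forall k, [set: F j] #<= [set: F k].
Proof.
pose sep : set (set (forall j, F j)) := [set G | forall f g j,
  G f -> G g -> f j = g j -> f = g].
have [A AP totA|G [Gsep maxG]] := @Zorn_bigcup _ sep.
  move=> f g j [G AG Gf] [H AH Hg].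
  have [GH|HG] := totA _ _ AG AH.
    by apply: AP AH _ _ _ _ Hg => //; exact: GH.
  by apply: AP AG _ _ _ Gf _; exact: HG.
have [[j Gj]|nG] := pselect (exists j, forall t : F j, exists2 f, G f & f j = t).
  exists j => k.
  have /choice[h hG] (t : F j) : exists f, G f /\ f j = t.
    by have [f] := Gj t; exists f.
  apply: (@injective_card_le _ _ (fun t => h t k)) => t u htu.
  have [[Gt <-] [Gu <-]] := (hG t, hG u).
  by congr (_ j); exact: Gsep htu.
have newP j : exists t : F j, forall f, G f -> f j <> t.
  apply: contrapT => nt; apply: nG; exists j => t.
  apply: contrapT => nf; apply: nt; exists t => f Gf fj.
  by apply: nf; exists f.
pose new j := projT1 (cid (newP j)).
have newN f j : G f -> f j <> new j by exact: projT2 (cid (newP j)) f.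
have /maxG[] : G `<` G `|` [set new].
  split=> [f|]; first by left.
  by move=> /(_ new (or_intror erefl))/(newN _ j0).
move=> f g j [Gf|->] [Gg|->]//.
- exact: Gsep.
- by move/newN.
- by move=> /esym/newN.
Qed.

(** * Strict bases *)

Section StrictBases.
Variables (R : comPzRingType) (X : lmodType R).
Hypotheses (Rreg : regular_ring R) (Xlc : laterally_complete_module X).
Implicit Types (e q p : R) (T U : Type).

Definition has_basis e T := exists x : T -> X, basis e x.

(** The concrete form of strict homogeneity of the module [eX]: see
[strictly_homogeneousP]. *)
Definition strict_basis e T := has_basis e T /\
  (forall q U, part e q -> has_basis q U -> [set: T] #<= [set: U]).

Lemma has_basis_card e T U : [set: T] #= [set: U] ->
  has_basis e T -> has_basis e U.
Proof.
move=> /card_esym/card_eq_bijective[f fbij] [x xb]; exists (x \o f).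
exact: basis_bij.
Qed.

Lemma has_basis_part e q T : part e q -> has_basis e T -> has_basis q T.
Proof. by move=> eq [x xb]; exists x; exact: basis_part xb. Qed.

Lemma strict_basis_card e T U : [set: T] #= [set: U] ->
  strict_basis e T -> strict_basis e U.
Proof.
move=> TU [Tb Tmin]; split; first exact: has_basis_card Tb.
by move=> q V eq /(Tmin q V eq); rewrite (card_le_eql TU).
Qed.

Lemma strict_basis_part e q T : part e q -> strict_basis e T -> strict_basis q T.
Proof.
move=> eq [Tb Tmin]; split; first exact: has_basis_part Tb.
by move=> p U qp; apply: Tmin; exact: part_trans qp.
Qed.

Lemma strict_basis_unique e T U : e * e = e -> e != 0 ->
  strict_basis e T -> strict_basis e U -> [set: T] #= [set: U].
Proof.
move=> ee e0 [Tb Tmin] [Ub Umin]; rewrite card_eq_le.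
by rewrite (Tmin e U)// (Umin e T).
Qed.

Lemma strict_basis_local e T : e * e = e ->
  dense e [set q | strict_basis q T] -> strict_basis e T.
Proof.
move=> ee dT; split; first by apply: basis_glue => //; apply: dense_sub dT => q [].
move=> q U eq Ub; have [q' qq' [_ Tmin]] := dT q eq; apply: (Tmin q').
  by case: qq' => q'q' _ q'0; exact: part_refl.
exact: has_basis_part qq' Ub.
Qed.

(** A basis is injective, so up to equipotence every cardinality of a basis is
found among the subsets of [X]; this turns the class of all cardinalities that
occur into a set. *)
Lemma has_basis_range e T : e != 0 -> has_basis e T ->
  exists2 S : set X, [set: T] #= [set: S] & has_basis e S.
Proof.
move=> e0 [x xb]; have [ix _] := xb.
have x_inj : injective x.
  move=> t u xtu; apply: contrapT => tu.
  have /(_ _ t) := ix [:: (1, t); (-1, u)].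
  rewrite /lincomb /coef !big_cons !big_nil /= xtu scaleN1r scale1r addr0 subrr.
  rewrite scaler0 asboolT// asboolF; last exact: nesym.
  by move=> /(_ erefl)/eqP; rewrite addr0 mulr1 (negbTE e0).
have TS : [set: T] #= [set: range x].
  apply: card_eq_trans (card_setT_sym _).
  by apply/card_esym/inj_card_eq => ? ? _ _ /x_inj.
by exists (range x) => //; apply: has_basis_card TS _; exists x.
Qed.

(** Shrinking the idempotent only adds cardinalities of bases. Where the least
one over all parts of [q] is attained, no further shrinking can lower it. *)
Lemma strict_basis_dense e : dense e [set q | exists T, strict_basis q T].
Proof.
move=> q eq; have [qq _ q0] := eq.
pose J := {S : set X | exists2 p, part q p & has_basis p S}.
have [p0 [S0 [qp0 S0b]]] := local_basis Rreg Xlc qq q0.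
have J0 : J by exists S0; exists p0.
have [[S [p qp Sb]] Smin] := least_card (fun j : J => sval j : set X) J0.
exists p => //; exists S; split=> // p' U pp' Ub; have [_ _ p'0] := pp'.
have [S' US' S'b] := has_basis_range p'0 Ub.
rewrite (card_le_eqr US').
have S'J : exists2 p, part q p & has_basis p S'.
  by exists p' => //; exact: part_trans pp'.
exact: (Smin (exist _ S' S'J)).
Qed.

End StrictBases.

(** * Corners of the ring and of the module *)

Section Corners.
Variables (R : comPzRingType) (X : lmodType R) (e : nabla R).
Implicit Types (c : corner e) (z : X) (a : R).

Fact cut_subproof a : corner_pred e (val e * a).
Proof. by rewrite /corner_pred mulrA nablaP. Qed.
Definition cut a : corner e := exist _ (val e * a) (cut_subproof a).

Fact cutm_subproof z : @restr_pred R X e (val e *: z).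
Proof. by rewrite /restr_pred scalerA nablaP. Qed.
Definition cutm z : restr X e := exist _ (val e *: z) (cutm_subproof z).

Lemma corner_le c : val e * val c = val c.
Proof. exact/eqP/(valP c). Qed.

Lemma cutK a : val e * a = a -> val (cut a) = a.
Proof. by []. Qed.

Lemma val_restr_scale c (y : restr X e) : val (c *: y) = val c *: val y.
Proof. by []. Qed.

Lemma part_corner (c d : corner e) : part c d <-> part (val c) (val d).
Proof.
split=> -[dd cd d0]; split.
- exact: (congr1 val dd).
- exact: (congr1 val cd).
- by apply: contra_neq d0 => d0; exact: val_inj.
- exact: val_inj.
- exact: val_inj.
- by apply: contra_neq d0 => ->.
Qed.

Lemma dense_corner c (D : set R) :
  dense c [set d | D (val d)] <-> dense (val c) D.
Proof.
split=> Dc q.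
  move=> [qq cq q0].
  have eq : val e * q = q by rewrite -cq mulrA corner_le.
  have [|d /part_corner qd Dd] := Dc (cut q).
    by apply/part_corner; rewrite cutK.
  by exists (val d) => //; rewrite cutK in qd.
move=> /part_corner/Dc[p qp Dp].
have ep : val e * p = p by case: qp => _ <- _; rewrite mulrA corner_le.
exists (cut p); first by apply/part_corner; rewrite cutK.
by rewrite /= ep.
Qed.

Lemma val_lincomb (I : Type) (y : I -> restr X e) (s : seq (corner e * I)) :
  val (lincomb y s) = lincomb (fun i => val (y i)) [seq (val p.1, p.2) | p <- s].
Proof. by rewrite /lincomb big_map (raddf_sum (val : restr X e -> X)). Qed.

Lemma val_coef (I : Type) (s : seq (corner e * I)) t :
  val (coef s t) = coef [seq (val p.1, p.2) | p <- s] t.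
Proof. by rewrite /coef big_map (raddf_sum (val : corner e -> R)). Qed.

Lemma val_cut_seq (I : Type) (s : seq (R * I)) :
  [seq (val p.1, p.2) | p <- [seq (cut p.1, p.2) | p <- s]] = scale_seq (val e) s.
Proof. by rewrite -map_comp. Qed.

Lemma basis_restr c (I : Type) (y : I -> restr X e) :
  basis c y <-> basis (val c) (fun i => val (y i)).
Proof.
have ce (d : corner e) z : val d *: (val e *: z) = val d *: z.
  by rewrite scalerA mulrC corner_le.
split=> -[iy sy]; split.
- move=> s cs0 t; pose s' := [seq (cut p.1, p.2) | p <- s].
  have /iy/(_ t)/(congr1 val) : c *: lincomb y s' = 0.
    apply: val_inj; rewrite val_restr_scale val_lincomb val_cut_seq.
    by rewrite lincomb_scale ce cs0.
  rewrite [LHS](_ : _ = val c * val (coef s' t))// val_coef val_cut_seq.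
  by rewrite coef_scale mulrA (mulrC (val c)) corner_le.
- move=> z; apply/dense_corner; apply: dense_sub (sy (cutm z)) => d [s ds].
  exists [seq (val p.1, p.2) | p <- s].
  by rewrite -val_lincomb -val_restr_scale -ds val_restr_scale ce.
- move=> s cs0 t; apply: val_inj => /=.
  by rewrite val_coef iy// -val_lincomb -val_restr_scale cs0.
- move=> z; have /dense_corner := sy (val z); apply: dense_sub => d [s ds].
  exists [seq (cut p.1, p.2) | p <- s]; apply: val_inj.
  by rewrite !val_restr_scale val_lincomb val_cut_seq lincomb_scale ce.
Qed.

Lemma has_basis_restr c (T : Type) :
  has_basis (restr X e) c T <-> has_basis X (val c) T.
Proof.
split=> [[y /basis_restr yb]|[x xb]]; first by exists (fun t => val (y t)).
exists (fun t => cutm (x t)); apply/basis_restr; apply: basis_eq xb => t /=.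
by rewrite scalerA mulrC corner_le.
Qed.

Lemma restr_faithful : faithful_module X -> faithful_module (restr X e).
Proof.
move=> Xf c c0; have [|z cz] := Xf (mknabla (congr1 val (nablaP c))).
  by apply: contra_neq c0 => c0; exact: val_inj.
exists (cutm z); apply: contra_neq cz => /(congr1 val) /=.
by rewrite scalerA mulrC corner_le.
Qed.

Lemma restr_separated : separated X -> separated (restr X e).
Proof.
move=> Xsep y c cc dy; apply: val_inj; rewrite val_restr_scale.
apply: Xsep; first exact: (congr1 val cc).
apply/dense_corner; apply: dense_sub dy => d /(congr1 val).
by rewrite val_restr_scale.
Qed.

Lemma restr_lcomplete : laterally_complete_module X ->
  laterally_complete_module (restr X e).
Proof.
move=> Xlc; split; first exact/regular_moduleP/restr_separated/lcomplete_separated.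
move=> I f y /partition_of_unityP[df exf].
pose M : set R := range (fun i => val (val (f i))).
have exM : exhausts (val e) M.
  split=> [_ [i _ <-]|_ _ [i _ <-] [j _ <-] ij|q eq].
  - by split; [exact: (congr1 val (nablaP (f i)))|exact: corner_le].
  - by apply: (congr1 val (df i j _)) => ijE; rewrite ijE in ij.
  - have [_ eqq _] := eq.
    have [|i qi] := exf (cut q); first by apply/part_corner; rewrite cutK.
    exists (val (val (f i))); first by exists i.
    by apply: contra_neq qi => qi; apply: val_inj; rewrite /= eqq.
have /choice[x xP] p : exists x : X, forall i, p = val (val (f i)) ->
    p *: x = p *: val (y i).
  have [[i pi]|np] := pselect (exists i, p = val (val (f i))); last first.
    by exists 0 => i pi; case: np; exists i.
  exists (val (y i)) => j pj; have [->//|ij] := pselect (i = j).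
  have : p * p = 0 by rewrite {1}pi pj; exact: (congr1 val (df i j ij)).
  have -> : p * p = p by rewrite pj; exact: (congr1 val (nablaP (f j))).
  by move=> ->; rewrite !scale0r.
have [z zx] := glue Xlc x (nablaP e) exM.
exists (cutm z) => i; apply: val_inj; rewrite !val_restr_scale /=.
rewrite scalerA mulrC corner_le zx; last by exists i.
exact: xP.
Qed.

End Corners.

Lemma homogeneousP (R : comPzRingType) (X : lmodType R) (T : Type) :
  faithful_module X -> laterally_complete_module X ->
  homogeneous X T <-> has_basis X 1 T.
Proof.
move=> Xf Xlc; split=> [[_ _ [I [x [/hamel_basisP xb IT]]]]|[x xb]].
  by apply: has_basis_card IT _; exists x.
by split=> //; exists T, x; split; [exact/hamel_basisP|exact: card_eqxx].
Qed.

(** Parts of the unity of [eR] are parts of [e], and a corner of a corner is a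
corner, so all the modules in the definition of strict homogeneity can be
replaced by [X] itself with a smaller idempotent. *)
Lemma strictly_homogeneousP (R : comPzRingType) (X : lmodType R) (e : nabla R)
    (T : Type) : faithful_module X -> laterally_complete_module X ->
  strictly_homogeneous (restr X e) T <-> strict_basis X (val e) T.
Proof.
move=> Xf Xlc; have Yf := restr_faithful (e := e) Xf; have Ylc := restr_lcomplete e Xlc.
have homE U : homogeneous (restr X e) U <-> has_basis X (val e) U.
  split=> [/(homogeneousP _ Yf Ylc)/has_basis_restr//|Ub].
  exact/(homogeneousP _ Yf Ylc)/has_basis_restr.
have homcE (c : nabla (corner e)) U :
    homogeneous (restr (restr X e) c) U <-> has_basis X (val (val c)) U.
  have [Zf Zlc] := (restr_faithful (e := c) Yf, restr_lcomplete c Ylc).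
  split=> [/(homogeneousP _ Zf Zlc)/has_basis_restr/has_basis_restr//|Ub].
  exact/(homogeneousP _ Zf Zlc)/has_basis_restr/has_basis_restr.
split=> [[/homE Tb Tmin]|[Tb Tmin]]; split=> //.
- move=> q U [qq eq q0].
  pose d := cut e q.
  have dd : d * d = d by apply: val_inj; rewrite /= eq.
  have d0 : d != 0 by apply: contra_neq q0 => /(congr1 val) /=; rewrite eq.
  have [_ /(_ U)] := Tmin (mknabla dd) d0.
  by move=> h qU; apply: h; apply/homcE; rewrite /= eq.
- exact/homE.
- move=> c c0.
  have ec : part (val e) (val (val c)).
    split; [exact: (congr1 val (nablaP c))|exact: corner_le|].
    by apply: contra_neq c0 => c0; exact: val_inj.
  split; first exact/homcE/(has_basis_part ec).
  by move=> U /homcE; exact: Tmin.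
Qed.

(** * Existence of the passport *)

(** For each cardinality [T] the idempotents with a strict [T]-basis have a
largest element, their supremum, since having a strict basis is local. The
nonzero idempotents that arise in this way are disjoint for different
cardinalities and have supremum [1] because strict bases are dense. They serve
as their own index set, so that no representatives of cardinals are needed. *)
Lemma passport_exists (R : comPzRingType) (X : lmodType R) :
  regular_ring R -> laterally_complete_ring R ->
  faithful_module X -> laterally_complete_module X ->
  exists (I : Type) (e : I -> nabla R) (T : I -> Type), passport_family X e T.
Proof.
move=> Rreg [Rsup _] Xf Xlc.
pose largest (e : nabla R) (T : Type) := strict_basis X (val e) T /\
  forall e' : nabla R, strict_basis X (val e') T -> (e' <= e)%O.
have largestP T : exists e, largest e T.
  pose L := [set e : nabla R | strict_basis X (val e) T].
  have [e supLe] := Rsup L; exists e; have [ubL _] := supLe; split=> //.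
  apply: strict_basis_local; [exact: Rreg|exact: Xlc|exact: nablaP|].
  have [_ dL] := (supremumsP _ _).1 supLe.
  move=> q /[dup] eq /dL[l Ll ql]; have [qq _ _] := eq.
  exists (q * val l); first exact: part_mull qq (nablaP l) ql.
  exact: strict_basis_part (part_mulr qq (nablaP l) ql) Ll.
pose D := [set e : nabla R | val e != 0 /\ exists T, largest e T].
have /choice[T TP] (i : D) : exists T, largest (val i) T by case: (set_valP i).
have eqD (i j : D) : [set: T i] #= [set: T j] -> i = j.
  move=> Tij; apply/val_inj/eqP; rewrite eq_le.
  have [[Ti maxi] [Tj maxj]] := (TP i, TP j).
  rewrite maxj ?maxi//; first exact: strict_basis_card (card_esym Tij) Tj.
  exact: strict_basis_card Tij Ti.
exists D, (fun i : D => val i), T; split.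
- apply/partition_of_unityP; split=> [i j ij|q q1].
    apply: contrapT => /eqP eij; apply/ij/eqD.
    have [ei ej] := (nablaP (val i), nablaP (val j)).
    have [[Ti _] [Tj _]] := (TP i, TP j).
    have pi := part_mull ei ej eij; have pj := part_mulr ei ej eij.
    have [pp _ p0] := pi.
    exact: strict_basis_unique pp p0 (strict_basis_part pi Ti)
                                     (strict_basis_part pj Tj).
  have [qq _ q0] := q1.
  have [p qp [U Ub]] := strict_basis_dense Rreg Xlc (part_refl qq q0).
  have [pp _ p0] := qp; have [e eU] := largestP U.
  have /nabla_leP/= ep : (mknabla pp <= e)%O by apply: eU.2.
  have e0 : val e != 0 by apply: contra_neq p0 => e0; rewrite -ep e0 mul0r.
  have De : D e by split=> //; exists U.
  exists (SigSub (mem_set De)) => /=.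
  apply: contra_neq p0 => qe; have [_ qpp _] := qp.
  by rewrite -qpp -ep mulrA qe mul0r.
- by move=> i; case: (set_valP i).
- by move=> i j ij /eqD.
- by move=> i; apply/(strictly_homogeneousP _ _ Xf Xlc); case: (TP i).
Qed.

(** * Isomorphism from matching bases *)

Lemma isomorphic_of_graph (R : comPzRingType) (X Y : lmodType R)
    (G : X -> Y -> Prop) :
  (forall z, exists w, G z w) -> (forall w, exists z, G z w) ->
  (forall a z w z' w', G z w -> G z' w' -> G (a *: z + z') (a *: w + w')) ->
  (forall w, G 0 w -> w = 0) -> (forall z, G z 0 -> z = 0) ->
  isomorphic_modules X Y.
Proof.
move=> /choice[f fG] /choice[g gG] Glin G0 G0'.
have Gfun z w w' : G z w -> G z w' -> w = w'.
  move=> zw zw'; have := Glin (-1) _ _ _ _ zw' zw.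
  rewrite scaleN1r addNr scaleN1r addrC => /G0/eqP.
  by rewrite subr_eq0 => /eqP.
have Ginj z z' w : G z w -> G z' w -> z = z'.
  move=> zw zw'; have := Glin (-1) _ _ _ _ zw' zw.
  rewrite !scaleN1r addNr addrC => /G0'/eqP.
  by rewrite subr_eq0 => /eqP.
have f_linear : linear f.
  by move=> a z z'; apply: (Gfun (a *: z + z')) => //; exact: Glin.
pose F : {linear X -> Y} := HB.pack f (GRing.isLinear.Build R X Y *:%R f f_linear).
exists F; exists g => [z|w]; first exact: (Ginj _ _ (f z)).
exact: (Gfun (g w)).
Qed.

Section MatchedBases.
Variables (R : comPzRingType) (J : Type) (f : J -> nabla R).
Hypothesis fpart : partition_of_unity f.
Variable T : J -> Type.

Definition matched (X Y : lmodType R) (x : forall j, T j -> X)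
    (y : forall j, T j -> Y) (z : X) (w : Y) : set R :=
  [set q | exists j s, [/\ val (f j) * q = q, q *: z = q *: lincomb (x j) s &
                         q *: w = q *: lincomb (y j) s]].

(** The graph of the isomorphism sought: locally, [z] and [w] have the same
coordinates in the two families of bases. *)
Definition graph (X Y : lmodType R) (x : forall j, T j -> X)
    (y : forall j, T j -> Y) (z : X) (w : Y) := dense 1 (matched x y z w).

Section Graph.
Variables (X Y : lmodType R).
Hypothesis Ylc : laterally_complete_module Y.
Variables (x : forall j, T j -> X) (y : forall j, T j -> Y).
Hypothesis x_basis : forall j, basis (val (f j)) (@x j).

Lemma graph_sym z w : graph x y z w -> graph y x w z.
Proof. by apply: dense_sub => q [j [s [? ? ?]]]; exists j, s. Qed.

(** On densely many idempotents the coordinates of [z] prescribe a value in [Y],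
and these values glue. *)
Lemma graph_total z : exists w, graph x y z w.
Proof.
have [_ exf] := (partition_of_unityP _).1 fpart.
have dz : dense 1 [set q | exists w, matched x y z w q].
  move=> q q1; have [j qj] := exf q q1; have [qq _ _] := q1.
  have [_ /(_ z _ (part_mulr qq (nablaP _) qj))[q' qq' [s q's]]] := x_basis j.
  exists q'; first exact: part_trans (part_mull qq (nablaP _) qj) qq'.
  exists (lincomb (@y j) s), j, s; split=> //.
  have [_ <- _] := part_trans (part_mulr qq (nablaP _) qj) qq'.
  by rewrite mulrA nablaP.
have [M Mz exM] := exhaustion dz.
have /choice[w wP] p : exists w, M p -> matched x y z w p.
  by have [/Mz[w zw]|nMp] := pselect (M p); [exists w|exists 0].
have [v vw] := glue Ylc w (mulr1 1) exM.
exists v => q q1; have [Mi _ /(_ q q1)[p Mp qp]] := exM; have [pp _] := Mi p Mp.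
have [qq _ _] := q1; exists (q * p); first exact: part_mull.
have [j [s [jp ps ws]]] := wP p Mp; exists j, s; split.
- by rewrite mulrCA jp.
- by rewrite -!scalerA ps.
- by rewrite -!scalerA vw// ws.
Qed.

Lemma graph_linear a z w z' w' :
  graph x y z w -> graph x y z' w' -> graph x y (a *: z + z') (a *: w + w').
Proof.
have [df _] := fpart.
move=> zw zw' q /zw[p qp [i [s [ip ps ws]]]].
have [p' pp' [j [s' [jp' ps' ws']]]] := zw' p (part_le1 qp).
have [_ ppp' p'0] := pp'.
have ij : i = j.
  apply: contrapT => /df fij; move/eqP: p'0; apply.
  suff -> : p' = val (f i) * val (f j) * p' by rewrite fij mul0r.
  by rewrite -mulrA jp' -{2}ppp' mulrA ip.
(* Disjointness puts both arguments over the same basis on [p']. *)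
subst j; exists p'; first exact: part_trans qp pp'.
have p'E (V : lmodType R) (v v' : V) : p *: v = p *: v' -> p' *: v = p' *: v'.
  by move=> vv; rewrite -ppp' mulrC -!scalerA vv.
exists i, (scale_seq a s ++ s'); split=> //.
  rewrite lincomb_cat lincomb_scale !scalerDr ps'.
  by rewrite !(scalerA p') !(mulrC p') -!scalerA (p'E _ _ _ ps).
rewrite lincomb_cat lincomb_scale !scalerDr ws'.
by rewrite !(scalerA p') !(mulrC p') -!scalerA (p'E _ _ _ ws).
Qed.

(** Independence of [x j] makes the coordinates of [0] vanish, hence [w] vanishes
locally, and therefore globally. *)
Lemma graph0 w : graph x y 0 w -> w = 0.
Proof.
move=> G0; rewrite -[w]scale1r; apply: (lcomplete_separated Ylc); first exact: mulr1.
apply: dense_sub G0 => q [j [s [jq /esym qs0 qw]]].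
rewrite scaler0 in qs0; rewrite /= qw; apply: lincomb0 => t.
have [ix _] := x_basis j.
have := ix (scale_seq q s); rewrite lincomb_scale qs0 scaler0 => /(_ erefl t).
by rewrite coef_scale mulrA jq.
Qed.

End Graph.

Lemma isomorphic_of_bases (X Y : lmodType R) (x : forall j, T j -> X)
    (y : forall j, T j -> Y) :
  laterally_complete_module X -> laterally_complete_module Y ->
  (forall j, basis (val (f j)) (x j)) -> (forall j, basis (val (f j)) (y j)) ->
  isomorphic_modules X Y.
Proof.
move=> Xlc Ylc xb yb; apply: (isomorphic_of_graph (G := graph x y)).
- exact: graph_total.
- by move=> w; have [z wz] := graph_total Xlc x yb w; exists z; exact: graph_sym.
- exact: graph_linear.
- by move=> w; exact: graph0.
- by move=> z /graph_sym; exact: graph0.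
Qed.

End MatchedBases.

(** * Isomorphic modules and passports *)

Lemma basis_linear (R : comPzRingType) (X Y : lmodType R) (f : {linear X -> Y})
    (q : R) (T : Type) (x : T -> X) :
  bijective f -> basis q x -> basis q (f \o x).
Proof.
move=> [g fK gK] [ix sx].
have fE s : lincomb (f \o x) s = f (lincomb x s).
  by rewrite /lincomb linear_sum; apply: eq_bigr => p _; rewrite linearZ_LR.
split=> [s|w]; first by rewrite fE -linearZ_LR -[0](raddf0 f) => /(can_inj fK)/ix.
apply: dense_sub (sx (g w)) => p [s ps]; exists s.
by rewrite fE -linearZ_LR -ps linearZ_LR gK.
Qed.

Lemma isomorphic_modules_sym (R : comPzRingType) (X Y : lmodType R) :
  isomorphic_modules X Y -> isomorphic_modules Y X.
Proof.
move=> [f [g fK gK]]; have g_linear : linear g.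
  by move=> a u v; rewrite -{1}[u]gK -{1}[v]gK -linearP fK.
pose G : {linear Y -> X} := HB.pack g (GRing.isLinear.Build R Y X *:%R g g_linear).
by exists G; exists f.
Qed.

Lemma has_basis_isomorphic (R : comPzRingType) (X Y : lmodType R) (q : R)
    (T : Type) : isomorphic_modules X Y -> has_basis X q T -> has_basis Y q T.
Proof. by move=> [f fb] [x xb]; exists (f \o x); exact: basis_linear. Qed.

Lemma passport_isomorphic (R : comPzRingType) (X Y : lmodType R)
    (e : nabla R) (T : Type) :
  faithful_module X -> laterally_complete_module X ->
  faithful_module Y -> laterally_complete_module Y ->
  isomorphic_modules X Y -> passport X e T -> passport Y e T.
Proof.
move=> Xf Xlc Yf Ylc XY [I [f [U [[fpart f0 Uneq Ustrict] eT]]]].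
exists I, f, U; split=> //; split=> // i.
have /(strictly_homogeneousP _ _ Xf Xlc)[Ub Umin] := Ustrict i.
apply/(strictly_homogeneousP _ _ Yf Ylc); split.
  exact: has_basis_isomorphic XY Ub.
move=> q V qi /(has_basis_isomorphic (isomorphic_modules_sym XY)).
exact: Umin.
Qed.

Theorem theorem5p3 (K : fieldType) (A : comAlgType K) (X Y : lmodType A)
    (A_regular : regular_ring A)
    (A_lcomplete : laterally_complete_ring A)
    (X_faithful : faithful_module X)
    (X_lcomplete : laterally_complete_module X)
    (Y_faithful : faithful_module Y)
    (Y_lcomplete : laterally_complete_module Y) :
  same_passport X Y <-> isomorphic_modules X Y.
Proof.
split=> [XY|XY e T]; last first.
  split; apply: passport_isomorphic => //; exact: isomorphic_modules_sym.
have [I [f [U fU]]] := passport_exists A_regular A_lcomplete X_faithful X_lcomplete.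
have [fpart _ _ Ustrict] := fU.
have xb i : exists x : U i -> X, basis (val (f i)) x.
  by have /(strictly_homogeneousP _ _ X_faithful X_lcomplete)[] := Ustrict i.
(* The family witnessing that [(f i, U i)] belongs to the passport of [Y] may
   depend on [i]; only its member over [f i] matters. *)
have yb i : exists y : U i -> Y, basis (val (f i)) y.
  have : passport X (f i) (U i).
    by exists I, f, U; split=> //; exists i; split=> //; exact: card_eqxx.
  move=> /XY[J [g [V [[_ _ _ Vstrict] [j [<- VU]]]]]].
  have /(strictly_homogeneousP _ _ Y_faithful Y_lcomplete)[Vb _] := Vstrict j.
  exact: has_basis_card VU Vb.
exact: (isomorphic_of_bases fpart X_lcomplete Y_lcomplete
  (fun i => projT2 (cid (xb i))) (fun i => projT2 (cid (yb i)))).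
Qed.
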